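(* Let $\alpha \in [0,1]$. If $B\subseteq \mathbb{N}$ is a highly sparse set, then there exists a set $A\subset \mathbb{N}$ such that the sumset $A+B=\{a+b: a\in A, b\in B\}$ has asymptotic density $d(A+B) = \alpha$.
   Context: $\mathbb{N}=\{1,2,3,\ldots\}$. For $A\subseteq\mathbb{N}$, write $A(n)=\#(A\cap[1,n])$; the lower and upper asymptotic densities are $\underline{d}(A)=\liminf_{n\to\infty} A(n)/n$ and $\overline{d}(A)=\limsup_{n\to\infty}A(n)/n$, and if they are equal their common value is the asymptotic density $d(A)$. A set $B=\{b_1<b_2<\cdots\}\subseteq\mathbb{N}$ is called highly sparse if $B$ is either finite, or infinite with $b_{j+1}/b_j\to\infty$ as $j\to\infty$.
   Formalization: The set B is assumed nonempty; for B empty (finite, hence highly sparse) the sumset A+B is empty and has density 0, so the claim fails for every α > 0. *)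

(* Defs.v *)
From mathcomp Require Import all_boot all_order all_algebra.
From mathcomp Require Import all_classical all_reals all_analysis.

Set Implicit Arguments.
Unset Strict Implicit.
Unset Printing Implicit Defensive.

Import Order.TTheory GRing.Theory Num.Theory.
Import numFieldNormedType.Exports.

Local Open Scope classical_set_scope.
Local Open Scope ring_scope.

(* The natural numbers of the text start at 1; a subset of them is an
   A : set nat with A `<=` positive_nats. *)
Definition positive_nats : set nat := [set n | (0 < n)%N].

(* The number of elements of A in [1, n]. *)
Definition counting_function (A : set nat) (n : nat) : nat :=
  count (fun k => `[< A k >]) (iota 1 n).

Definition lower_density (R : realType) (A : set nat) : \bar R :=
  limn_einf (fun n => ((counting_function A n)%:R / n%:R : R)%:E).

Definition upper_density (R : realType) (A : set nat) : \bar R :=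
  limn_esup (fun n => ((counting_function A n)%:R / n%:R : R)%:E).

Definition has_density (R : realType) (A : set nat) (alpha : R) : Prop :=
  lower_density R A = alpha%:E /\ upper_density R A = alpha%:E.

Definition sumset (A B : set nat) : set nat :=
  [set (a + b)%N | a in A & b in B].

(* In the infinite case b is the (unique) increasing enumeration of B,
   indexed from 0. *)
Definition highly_sparse (R : realType) (B : set nat) : Prop :=
  finite_set B \/
  (infinite_set B /\
   exists b : nat -> nat,
     [/\ {homo b : i j / (i < j)%N >-> (i < j)%N},
         range b = B &
         ((b j.+1)%:R / (b j)%:R : R) @[j --> \oo] --> +oo]).

(* Main.v *)
Require Import Defs.
From mathcomp Require Import all_boot all_order all_algebra.
From mathcomp Require Import all_classical all_reals all_analysis.
From mathcomp Require Import zify ring lra.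

(** Enumerate [B] as [b 0 < b 1 < ...] and pick scales [b k << P k << N k << b k.+1]
    such that [b k.+1] is, up to an error [o(P k)], a multiple of [P k]. In the block
    [N k <= x < N k.+1] let [A] consist of the [x] with [x mod P k < alpha * P k], so
    that [A] has density [alpha]. Up to the end of that block only the shifts by
    [b 0, ..., b k.+1] matter: those by at most [b k] and the one by [b k.+1] move
    residues mod [P k] by [o(P k)], so each window of length [P k] gains [o(P k)]
    elements. Summands [a] from earlier blocks only produce elements of
    [[N k, N k + b k)] and [[b k.+1, b k.+1 + N k)], which are negligible. Hence
    [A + B] exceeds [A] by [o(n)], while it contains a translate of [A].
    A finite [B] is handled by taking [b j = M * (j+1)!] with [B] below [M]. *)

Set Implicit Arguments.
Unset Strict Implicit.
Unset Printing Implicit Defensive.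

Import Order.TTheory GRing.Theory Num.Theory.
Import numFieldNormedType.Exports.

(** * Counting on initial segments and in residue classes *)

(* Counts on [[0, v)], unlike [counting_function], which counts on [[1, n]]. *)
Definition cnt (p : pred nat) (v : nat) : nat := count p (iota 0 v).

Lemma cntS (p : pred nat) (v : nat) : cnt p v.+1 = cnt p v + p v.
Proof. by rewrite /cnt -addn1 iotaD count_cat /= addn0. Qed.

Lemma cnt_leq (p : pred nat) (v : nat) : cnt p v <= v.
Proof. by rewrite -{2}(size_iota 0 v) count_size. Qed.

Lemma cntU (p q : pred nat) (v : nat) :
  cnt (fun x => p x || q x) v <= cnt p v + cnt q v.
Proof.
by elim: v => [|v IH] //; rewrite !cntS; case: (p v) (q v) => [] [] /=; lia.
Qed.

(** The additive form stands for a comparison of increments over [u, v) without truncated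
    subtraction. *)
Lemma cnt_sub_between (p q : pred nat) (u v : nat) : u <= v ->
  (forall x, u <= x < v -> p x -> q x) -> cnt p v + cnt q u <= cnt p u + cnt q v.
Proof.
elim: v => [|v IH]; first by rewrite leqn0 => /eqP ->.
rewrite leq_eqVlt ltnS => /predU1P[-> _|uv pq]; first by rewrite addnC.
have := IH uv (fun x hx => pq x ltac:(lia)).
rewrite !cntS; have := pq v; case: (p v) => /= h; last by lia.
by rewrite h //; lia.
Qed.

Lemma cnt_interval (c w v : nat) : cnt (fun x => c <= x < c + w) v = minn (v - c) w.
Proof. by elim: v => [|v IH]; [rewrite sub0n min0n|rewrite cntS IH; lia]. Qed.

Lemma cnt_modn (P h v : nat) : 0 < P -> h <= P ->
  cnt (fun x => x %% P < h) v = h * (v %/ P) + minn h (v %% P).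
Proof.
move=> P0 hP; elim: v => [|v IH]; first by rewrite div0n mod0n minn0 muln0.
rewrite cntS IH divnS // modnS; have := ltn_pmod v P0.
have [dvd rP|ndvd rP] := boolP (P %| v.+1); last by lia.
suff -> : v %% P = P.-1 by rewrite mulnDr; lia.
move: dvd; rewrite /dvdn => /eqP.
rewrite -addn1 -modnDml; have [e|ne] := eqVneq ((v %% P) + 1) P; first by lia.
by rewrite modn_small; lia.
Qed.

(** Multiplying by [P] keeps the density h / P within [nat]; the incomplete last period accounts for
    the [P * P]. *)
Lemma cnt_modn_bounds (P h v : nat) : 0 < P -> h <= P ->
  h * v <= P * cnt (fun x => x %% P < h) v <= h * v + P * P.
Proof.
move=> P0 hP; rewrite cnt_modn // {1 4}(divn_eq v P).
have := ltn_pmod v P0; set r := v %% P; set q := v %/ P => rP.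
by rewrite !mulnDr (mulnCA P h q) (mulnC P q); case: (leqP h r) => hr; nia.
Qed.

(** * Blocks, scales and the block set *)

Lemma block_exists (N : nat -> nat) (K v : nat) : (forall k, N k < N k.+1) ->
  N K <= v -> exists2 k, K <= k & N k <= v < N k.+1.
Proof.
move=> incr NK.
have Nk k : k <= N k by elim: k => // k IH; apply: leq_ltn_trans IH (incr k).
have ub k : N k <= v -> k <= v by apply: leq_trans.
case: (ex_maxnP (ex_intro (fun k => N k <= v) K NK) ub) => k kv kmax.
exists k; first exact: kmax.
by rewrite kv ltnNge; apply/negP => /kmax; rewrite ltnn.
Qed.

(* [m k] quantifies the separations [b k << P k << N k << b k.+1]; moreover
   [b k.+1] is almost a multiple of [P k]. *)
Record scales (b P N m : nat -> nat) : Prop := Scales {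
  b_gt0 : forall k, 0 < b k;
  b_homo : {homo b : i j / i <= j};
  m_gt1 : forall k, 1 < m k;
  m_b_le : forall k, m k * b k <= P k;
  m_rem_le : forall k, m k * (b k.+1 %% P k) <= P k;
  m_P_le : forall k, m k * P k <= N k;
  m_N_le : forall k, m k * N k <= b k.+1;
  m_div : forall c, exists K, forall k, K <= k -> c <= m k }.

Definition block_set (P N h : nat -> nat) : set nat :=
  [set x | exists k, N k <= x < N k.+1 /\ x %% P k < h k].

Lemma scales_P_gt0 b P N m (sc : scales b P N m) k : 0 < P k.
Proof. by have := m_b_le sc k; have := b_gt0 sc k; have := m_gt1 sc k; nia. Qed.

Lemma scales_b_leP b P N m (sc : scales b P N m) k : b k <= P k.
Proof. by have := m_b_le sc k; have := m_gt1 sc k; nia. Qed.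

Lemma scales_P_leN b P N m (sc : scales b P N m) k : P k <= N k.
Proof. by have := m_P_le sc k; have := m_gt1 sc k; nia. Qed.

Lemma scales_mN_leN b P N m (sc : scales b P N m) k : m k * N k <= N k.+1.
Proof.
apply: leq_trans (m_N_le sc k) _.
exact: leq_trans (scales_b_leP sc _) (scales_P_leN sc _).
Qed.

Lemma scales_N_lt b P N m (sc : scales b P N m) k : N k < N k.+1.
Proof.
have := scales_mN_leN sc k; have := m_gt1 sc k; have := scales_P_gt0 sc k.
by have := scales_P_leN sc k; nia.
Qed.

Lemma scales_N_homo b P N m : scales b P N m -> {homo N : i j / i <= j}.
Proof.
move=> sc; apply: homo_leq leqnn leq_trans _ => k.
exact/ltnW/(scales_N_lt sc).
Qed.

(** Blocks are disjoint because [N] is increasing, so the index in [block_set] is forced. *)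
Lemma block_setE b P N m h k x : scales b P N m -> N k <= x < N k.+1 ->
  block_set P N h x <-> x %% P k < h k.
Proof.
move=> sc /andP[Nx xN]; split=> [[j [/andP[Njx xNj] hx]]|hx]; last first.
  by exists k; rewrite Nx xN.
suff -> : k = j by [].
have [lt_kj|lt_jk|//] := ltngtP k j.
  by have := scales_N_homo sc lt_kj; lia.
by have := scales_N_homo sc lt_jk; lia.
Qed.

Lemma block_sumset b P N m h (B : set nat) k x : scales b P N m ->
  (forall y, B y -> y <= b 0 \/ exists j, y = b j) ->
  N k <= x < N k.+1 -> sumset (block_set P N h) B x ->
  [|| x %% P k < h k + maxn (b k) (b k.+1 %% P k), N k <= x < N k + b k |
      b k.+1 <= x < b k.+1 + N k].
Proof.
move=> sc Bb /andP[Nx xN] [a Aa [y By axy]].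
have aN : a < N k.+1 by lia.
have yP : y <= b k \/ y = b k.+1.
  case: (Bb y By) => [yb0|[j yj]]; first by left; apply: leq_trans yb0 (b_homo sc _).
  have [jk|] := leqP j k; first by left; rewrite yj (b_homo sc).
  rewrite leq_eqVlt => /predU1P[->|/(b_homo sc)]; first by right.
  (* [b k.+2] is at least [m k.+1 * N k.+1], hence exceeds [x]. *)
  by have := m_N_le sc k.+1; have := m_gt1 sc k.+1; nia.
have [aNk|Nka] := ltnP a (N k).
  by case: yP => yb; apply/or3P; [apply: Or32|apply: Or33]; lia.
move: Aa; rewrite (@block_setE b P N m h k) ?Nka ?aN // => ah.
(* Wrapping around mod [P k] only lowers a residue, so the sum of the two residues is an upper
   bound. *)
apply/or3P/Or31; rewrite -axy -modnDm; apply: leq_ltn_trans (leq_mod _ _) _.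
case: yP => [yb|->]; last by lia.
by have := leq_mod y (P k); lia.
Qed.

(** * Construction of the scales *)

Lemma scales_exist (b : nat -> nat) : (forall k, 0 < b k) ->
  {homo b : i j / i < j} ->
  (forall c, exists J, forall j, J <= j -> c * b j <= b j.+1) ->
  exists K P N m, scales (fun k => b (k + K)) P N m.
Proof.
move=> b0 bhomo bdiv.
have bk k : k <= b k.
  by elim: k => // k IH; apply: leq_ltn_trans IH (bhomo _ _ (ltnSn k)).
(* Of the four factors [i], two separate [b k] from [P k], one [P k] from [N k] and one [N k] from
   [b k.+1]. The cap [i <= k] ensures that the maximum exists and is at most [b k]. *)
pose good k i := (i <= k) && (i ^ 4 * b k <= b k.+1).
have good0 k : exists i, good k i by exists 0.
have goodub k i : good k i -> i <= k by case/andP.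
pose m0 k := ex_maxn (good0 k) (goodub k).
have m0P k : good k (m0 k) by rewrite /m0; case: ex_maxnP.
have m0max k i : good k i -> i <= m0 k by rewrite /m0; case: ex_maxnP => j _; exact.
have m0div c : exists K, forall k, K <= k -> c <= m0 k.
  have [J HJ] := bdiv (c ^ 4); exists (maxn J c) => k Jk.
  by apply: m0max; rewrite /good HJ ?andbT; lia.
(* Dropping the first [K] terms makes [m k] at least 2 throughout. *)
have [K HK] := m0div 2.
pose m k := m0 (k + K); pose P k := b (k + K).+1 %/ (m k) ^ 2.
have m2 k : 1 < m k by apply: HK; rewrite leq_addl.
have mb k : m k <= b (k + K) by case/andP: (m0P (k + K)) => /leq_trans ->.
have mmb k : m k ^ 2 * b (k + K) <= P k.
  rewrite leq_divRL ?expn_gt0 ?(ltnW (m2 k)) // mulnAC -expnD.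
  by case/andP: (m0P (k + K)).
exists K, P, (fun k => m k * P k), m; split=> //=.
- by move=> i j ij; apply: (ltnW_homo bhomo); rewrite leq_add2r.
- by move=> k; apply: leq_trans (mmb k); rewrite leq_mul2r; have := m2 k; nia.
(* As [P k] is a quotient by [m k ^ 2], the remainder mod [P k] is below [m k ^ 2], and
   [m k ^ 3 <= m k ^ 2 * b (k + K) <= P k]. *)
- move=> k; apply: leq_trans (mmb k).
  have m20 : 0 < m k ^ 2 by rewrite expn_gt0 (ltnW (m2 k)).
  have := ltn_pmod (b (k + K).+1) m20.
  have -> : b (k.+1 + K) %% P k = (b (k + K).+1 %% m k ^ 2) %% P k.
    by rewrite addSn {1}(divn_eq (b (k + K).+1) (m k ^ 2)) mulnC modnMDl.
  have := leq_mod (b (k + K).+1 %% m k ^ 2) (P k).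
  by have := mb k; nia.
- by move=> k; rewrite mulnA mulnn addSn mulnC leq_trunc_div.
move=> c; have [K' HK'] := m0div c; exists K' => k kK.
by apply: HK'; apply: leq_trans kK (leq_addr _ _).
Qed.

(** The alternative [y <= b 0] in the last clause covers finite [B] and lets initial terms of [b] be
    dropped later. *)
Lemma highly_sparse_gaps (R : realType) (B : set nat) :
  (B `<=` positive_nats)%classic -> highly_sparse R B ->
  exists b : nat -> nat, [/\ forall k, 0 < b k, {homo b : i j / i < j},
    forall c, exists J, forall j, J <= j -> c * b j <= b j.+1 &
    forall y, B y -> y <= b 0 \/ exists j, y = b j].
Proof.
move=> Bpos [finB|[infB [b [bhomo rangeb bdiv]]]]; last first.
  have b0 k : 0 < b k by apply: Bpos; rewrite -rangeb; exists k.
  exists b; split=> // [c|y]; last by rewrite -rangeb => -[j _ <-]; right; exists j.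
  have /cvgryPge/(_ (c%:R : R)%R) [J _ HJ] := bdiv.
  exists J => j Jj; have := HJ j Jj.
  by rewrite /= ler_pdivlMr ?ltr0n // -natrM ler_nat.
have [M BM] : exists M, forall y, B y -> y <= M.
  move: finB => /finite_fsetP[X ->].
  exists (\max_(y <- finmap.enum_fset X) y) => y /= yX.
  exact: (leq_bigmax_seq (F := id)).
have b0 j : 0 < M.+1 * (j.+1)`! by rewrite muln_gt0 fact_gt0.
exists (fun j => M.+1 * (j.+1)`!); split=> //.
- apply: homo_ltn ltn_trans _ => j; rewrite ltn_pmul2l // (factS j.+1).
  by have := fact_gt0 j.+1; nia.
- move=> c; exists c => j cj.
  by rewrite mulnCA leq_pmul2l // (factS j.+1) leq_mul2r; apply/orP; right; lia.
by move=> y /BM yM; left; rewrite factS fact0 !muln1 leqW.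
Qed.

(** * From block estimates to density *)

Local Open Scope ring_scope.

(** Two steps suffice, with no sum over all blocks: back to the start of the block of [v], then
    through the preceding block to its start [N k]. That point is already at most [v / c], so the
    trivial bound on [f (N k)] serves. *)
Lemma block_growth (R : realType) (f : nat -> R) (C : R) b P N m :
  scales b P N m -> 0 <= C -> (forall v, f v <= v%:R) ->
  (forall k v, (N k <= v <= N k.+1)%N -> f v <= f (N k) + C * v%:R / (m k)%:R) ->
  forall e, 0 < e -> exists V, forall v, (V <= v)%N -> f v <= e * v%:R.
Proof.
move=> sc C0 fle fblock e e0.
(* The [2 * C] pays for the two block steps, the 1 for the trivial bound at [N k]. *)
pose c := (Num.truncn ((2 * C + 1) / e)).+1.
have c0 : 0 < c%:R :> R by rewrite ltr0n.
have cE : (2 * C + 1) / c%:R <= e.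
  by rewrite ler_pdivrMr // [e * _]mulrC -ler_pdivrMr // ltW // truncnS_gt.
have [K HK] := m_div sc c.
exists (N K.+1) => v NKv.
have [[|k] // Kk /andP[Nkv vNk]] := block_exists (scales_N_lt sc) NKv.
have step i w : (K <= i)%N -> (N i <= w <= N i.+1)%N ->
    f w <= f (N i) + C * w%:R / c%:R.
  move=> Ki /fblock; move/le_trans; apply; rewrite lerD2l ler_wpM2l //.
    by rewrite mulr_ge0.
  have mi : (c <= m i)%N by apply: HK.
  by rewrite lef_pV2 ?posrE ?ltr0n ?ler_nat //; lia.
have s1 := step k.+1 v (leqW Kk) ltac:(lia).
have s2 := step k (N k.+1) Kk ltac:(have := scales_N_lt sc k; lia).
have s3 : (N k)%:R <= v%:R / c%:R :> R.
  rewrite ler_pdivlMr // -natrM ler_nat; apply: leq_trans Nkv.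
  apply: leq_trans (scales_mN_leN sc k); rewrite mulnC leq_mul2r HK ?orbT //.
have s4 : C * (N k.+1)%:R / c%:R <= C * v%:R / c%:R.
  by rewrite ler_wpM2r ?invr_ge0 ?(ltW c0) // ler_wpM2l // ler_nat.
have s5 : (2 * C + 1) / c%:R * v%:R <= e * v%:R by rewrite ler_wpM2r.
have -> // := le_trans _ s5; have := fle (N k).
have -> : (2 * C + 1) / c%:R * v%:R = 2 * (C * v%:R / c%:R) + v%:R / c%:R by ring.
by lra.
Qed.

Lemma cnt_has_density (R : realType) (S : set nat) (alpha : R) :
  (forall e, 0 < e -> exists V, forall v, (V <= v)%N ->
     (cnt (fun x => `[< S x >]) v)%:R - alpha * v%:R <= e * v%:R) ->
  (forall e, 0 < e -> exists V, forall v, (V <= v)%N ->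
     alpha * v%:R - (cnt (fun x => `[< S x >]) v)%:R <= e * v%:R) ->
  has_density S alpha.
Proof.
move=> up lo; set p := fun x => `[< S x >] in up lo.
suff cvg : (((counting_function S n)%:R / n%:R : R)%:E @[n --> \oo]
    --> alpha%:E)%classic.
  by rewrite /has_density /lower_density /upper_density !(cvg_limn_einf_sup cvg).
apply: cvg_EFin; first exact: nearW.
apply/cvgrPdist_le => e e0 /=.
have e2 : 0 < e / 2 by rewrite divr_gt0.
have [V1 up1] := up _ e2; have [V2 lo1] := lo _ e2.
(* The last threshold gives [1 <= e / 2 * n], which absorbs the shift between [0, n) and [1, n]. *)
exists (maxn (maxn V1 V2) (Num.truncn (2 / e)).+1) => // n /= Vn.
have n0 : 0 < n%:R :> R by rewrite ltr0n (leq_trans _ Vn) // leq_max ltn0Sn orbT.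
have en : 1 <= e / 2 * n%:R.
  rewrite mulrAC ler_pdivlMr // mul1r mulrC -ler_pdivrMr //.
  by rewrite ltW // (lt_le_trans (truncnS_gt _)) // ler_nat (leq_trans _ Vn) ?leq_maxr.
have cE : (p 0 + counting_function S n = cnt p n + p n)%N by rewrite -cntS.
have c1 : (counting_function S n)%:R <= (cnt p n)%:R + 1 :> R.
  by rewrite natr1 ler_nat; lia.
have c2 : (cnt p n)%:R <= (counting_function S n)%:R + 1 :> R.
  by rewrite natr1 ler_nat; lia.
have := up1 n ltac:(lia); have := lo1 n ltac:(lia) => lo2 up2.
rewrite -[alpha](mulfK (lt0r_neq0 n0)) -mulrBl normrM normfV (gtr0_norm n0).
rewrite ler_pdivrMr // ler_norml.
have -> : e * n%:R = e / 2 * n%:R + e / 2 * n%:R by field.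
by apply/andP; split; lra.
Qed.

(** After multiplication by [P], both endpoint errors lie in [0, P * P], so their difference is at
    most [P * P] in absolute value. *)
Lemma cnt_modn_real (R : realType) (P h u v : nat) : (0 < P)%N -> (h <= P)%N ->
  let d := (cnt (fun x => x %% P < h)%N v)%:R -
           (cnt (fun x => x %% P < h)%N u)%:R in
  `|d - (h%:R / P%:R) * (v%:R - u%:R)| <= P%:R :> R.
Proof.
move=> P0 hP /=; have P0R : 0 < P%:R :> R by rewrite ltr0n.
have := cnt_modn_bounds u P0 hP; have := cnt_modn_bounds v P0 hP.
set cv := cnt _ v; set cu := cnt _ u.
rewrite -!(ler_nat R) !natrD !natrM => /andP[v1 v2] /andP[u1 u2].
have -> : cv%:R - cu%:R - h%:R / P%:R * (v%:R - u%:R) =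
    (P%:R * cv%:R - P%:R * cu%:R - h%:R * v%:R + h%:R * u%:R) / P%:R :> R.
  by field; rewrite gt_eqF.
rewrite normrM normfV (gtr0_norm P0R) ler_pdivrMr // ler_norml.
by apply/andP; split; lra.
Qed.

(** * Estimates within one block *)

(** One error [v / m k] bounds [P k], for incomplete periods; the other bounds the rounding of
    [alpha * P k] to [h k], which costs at most 1 / P k per integer. *)
Lemma block_set_lower (R : realType) (alpha : R) b P N m h k v :
  scales b P N m -> (h k <= P k)%N -> alpha * (P k)%:R <= (h k)%:R + 1 ->
  (N k <= v <= N k.+1)%N ->
  let p := fun x => `[< block_set P N h x >] in
  alpha * v%:R - (cnt p v)%:R <=
  alpha * (N k)%:R - (cnt p (N k))%:R + 2 * v%:R / (m k)%:R.
Proof.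
move=> sc hP ah /andP[Nv vN] /=; set p := fun x => `[< block_set P N h x >].
have P0 := scales_P_gt0 sc k.
have P0R : 0 < (P k)%:R :> R by rewrite ltr0n.
have m0R : 0 < (m k)%:R :> R by rewrite ltr0n; have := m_gt1 sc k; lia.
have cnt_p : (cnt (fun x => x %% P k < h k) v + cnt p (N k) <=
              cnt (fun x => x %% P k < h k) (N k) + cnt p v)%N.
  apply: cnt_sub_between => // x /andP[Nx xv] hx; apply/asboolP.
  by apply/(block_setE (k := k) h sc) => //; rewrite Nx (leq_trans xv vN).
have := cnt_modn_real R (N k) v P0 hP => /=; move: cnt_p.
set cv := cnt _ v; set cu := cnt _ (N k).
rewrite -(ler_nat R) !natrD ler_norml => cnt_p /andP[mlo _].
have NvR : (N k)%:R <= v%:R :> R by rewrite ler_nat.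
have e1 : (P k)%:R <= v%:R / (m k)%:R :> R.
  rewrite ler_pdivlMr // -natrM ler_nat mulnC.
  exact: leq_trans (m_P_le sc k) Nv.
have e2 : (alpha - (h k)%:R / (P k)%:R) * (v%:R - (N k)%:R) <= v%:R / (m k)%:R.
  apply: (@le_trans _ _ ((m k)%:R^-1 * (v%:R - (N k)%:R))).
    rewrite ler_wpM2r ?subr_ge0 //.
    apply: (@le_trans _ _ (P k)%:R^-1).
      by rewrite lerBlDr -(ler_pM2r P0R) mulrDl mulfVK ?gt_eqF // mulVf ?gt_eqF //
           addrC.
    rewrite lef_pV2 ?posrE // ler_nat.
    by have := m_b_le sc k; have := b_gt0 sc k; nia.
  by rewrite mulrC ler_wpM2r ?invr_ge0 ?(ltW m0R) // gerBl ler0n.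
by lra.
Qed.

(** The four errors [v / m k] come from incomplete periods, the widening of the residue window by
    [s], and the two exceptional intervals. *)
Lemma block_sumset_upper (R : realType) (alpha : R) b P N m h (B : set nat) k v :
  scales b P N m -> (forall y, B y -> (y <= b 0)%N \/ exists j, y = b j) ->
  (h k)%:R <= alpha * (P k)%:R -> (N k <= v <= N k.+1)%N ->
  let p := fun x => `[< sumset (block_set P N h) B x >] in
  (cnt p v)%:R - alpha * v%:R <=
  (cnt p (N k))%:R - alpha * (N k)%:R + 4 * v%:R / (m k)%:R.
Proof.
move=> sc Bb ha /andP[Nv vN] /=; set p := fun x => `[< sumset _ _ x >].
have P0 := scales_P_gt0 sc k.
have P0R : 0 < (P k)%:R :> R by rewrite ltr0n.
have m0R : 0 < (m k)%:R :> R by rewrite ltr0n; have := m_gt1 sc k; lia.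
pose s := maxn (b k) (b k.+1 %% P k).
(* The cap at [P k] meets the hypothesis of [cnt_modn_real] and loses nothing, residues being below
   [P k]. *)
pose h' := minn (h k + s) (P k).
have hP : (h' <= P k)%N by rewrite geq_minr.
pose q1 x := (x %% P k < h')%N.
pose q2 x := (N k <= x < N k + b k)%N.
pose q3 x := (b k.+1 <= x < b k.+1 + N k)%N.
have : (cnt p v + cnt (fun x => q1 x || (q2 x || q3 x)) (N k) <=
        cnt p (N k) + cnt (fun x => q1 x || (q2 x || q3 x)) v)%N.
  apply: cnt_sub_between => // x /andP[Nx xv] /asboolP Sx.
  have xk : (N k <= x < N k.+1)%N by rewrite Nx (leq_trans xv vN).
  by have := block_sumset sc Bb xk Sx; rewrite /q1 /h' leq_min ltn_pmod // andbT.
have q1N : (cnt q1 (N k) <= cnt (fun x => q1 x || (q2 x || q3 x)) (N k))%N.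
  by apply: sub_count => x /= ->.
have qU : (cnt (fun x => q1 x || (q2 x || q3 x)) v <=
    cnt q1 v + (cnt q2 v + cnt q3 v))%N.
  by apply: leq_trans (cntU _ _ _) _; rewrite leq_add2l cntU.
rewrite !cnt_interval in qU => qp.
have : (cnt p v + cnt q1 (N k) <=
    cnt p (N k) + (cnt q1 v + (b k + minn (v - b k.+1) (N k))))%N.
  by lia.
have := cnt_modn_real R (N k) v P0 hP => /=; rewrite -/q1.
rewrite -(ler_nat R) !natrD ler_norml => /andP[_ mup] cup.
have NvR : (N k)%:R <= v%:R :> R by rewrite ler_nat.
have e1 : (P k)%:R <= v%:R / (m k)%:R :> R.
  rewrite ler_pdivlMr // -natrM ler_nat mulnC.
  exact: leq_trans (m_P_le sc k) Nv.
have e2 : (b k)%:R <= v%:R / (m k)%:R :> R.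
  by apply: le_trans e1; rewrite ler_nat (scales_b_leP sc).
have e3 : (minn (v - b k.+1) (N k))%:R <= v%:R / (m k)%:R :> R.
  rewrite ler_pdivlMr // -natrM ler_nat.
  (* The interval at [b k.+1] contributes only once [v] exceeds [b k.+1], which is at least
     [m k * N k]. *)
  have [vb|bv] := leqP v (b k.+1); first by rewrite (eqP vb) min0n.
  apply: leq_trans (ltnW bv); apply: leq_trans (m_N_le sc k).
  by rewrite mulnC leq_mul2l geq_minr orbT.
have e4 : (h'%:R / (P k)%:R - alpha) * (v%:R - (N k)%:R) <= v%:R / (m k)%:R.
  apply: (@le_trans _ _ ((m k)%:R^-1 * (v%:R - (N k)%:R))).
    rewrite ler_wpM2r ?subr_ge0 // lerBlDr.
    rewrite ler_pdivrMr // mulrDl; apply: (@le_trans _ _ ((h k)%:R + s%:R)).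
      by rewrite -natrD ler_nat geq_minl.
    rewrite addrC lerD // mulrC ler_pdivlMr // -natrM ler_nat mulnC.
    by rewrite /s maxnMr geq_max (m_b_le sc) (m_rem_le sc).
  by rewrite mulrC ler_wpM2r ?invr_ge0 ?(ltW m0R) // gerBl ler0n.
by lra.
Qed.

(** The translate of [A] by [y] lies in the sumset, and lengthening the window by [y] adds at most
    [y] to a count. *)
Lemma cnt_sumset_ge (A B : set nat) (y v : nat) : B y ->
  (cnt (fun x => `[< A x >]) v <= cnt (fun x => `[< sumset A B x >]) v + y)%N.
Proof.
move=> By; pose S x := `[< sumset A B x >].
have shift : (cnt (fun x => `[< A x >]) v <= cnt S (v + y))%N.
  elim: v => // v IH; rewrite addSn !cntS leq_add //.
  case: asboolP => // Av; rewrite lt0b; apply/asboolP.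
  by exists v => //; exists y.
apply: leq_trans shift _; elim: y {By} => [|y IH]; first by rewrite !addn0.
by rewrite !addnS cntS; case: (S _) => /=; lia.
Qed.

(** * Assembling the set *)

Local Open Scope classical_set_scope.

Theorem theorem1p5 (R : realType) (alpha : R) (B : set nat)
    (alpha01 : 0 <= alpha <= 1)
    (Bpos : B `<=` positive_nats)
    (Bneq0 : B !=set0)
    (Bsparse : highly_sparse R B) :
  exists2 A : set nat, A `<=` positive_nats & has_density (sumset A B) alpha.
Proof.
have /andP[a0 a1] := alpha01.
have [b [b0 bhomo bdiv Bb]] := highly_sparse_gaps Bpos Bsparse.
have [K [P [N [m sc]]]] := scales_exist b0 bhomo bdiv.
(* The dropped terms of [b] fall under the alternative [y <= b (0 + K)]. *)
have {}Bb y : B y -> (y <= b (0 + K))%N \/ exists j, y = b (j + K)%N.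
  have mono := ltnW_homo bhomo.
  move=> /Bb [yb|[j ->]]; first by left; apply: leq_trans yb (mono _ _ _).
  have [jK|/ltnW Kj] := leqP j K; first by left; apply: mono.
  by right; exists (j - K)%N; rewrite subnK.
pose h k := Num.truncn (alpha * (P k)%:R).
have hE k : (h k)%:R <= alpha * (P k)%:R < (h k).+1%:R.
  by apply: truncn_itv; rewrite mulr_ge0.
have hlo k : (h k)%:R <= alpha * (P k)%:R by case/andP: (hE k).
have hup k : alpha * (P k)%:R <= (h k)%:R + 1.
  by rewrite natr1 ltW //; case/andP: (hE k).
have hP k : (h k <= P k)%N.
  by rewrite -(ler_nat R) (le_trans (hlo k)) // ler_piMl.
exists (block_set P N h).
  move=> x [k [/andP[Nx _] _]]; apply: leq_trans Nx.
  exact: leq_trans (scales_P_gt0 sc k) (scales_P_leN sc k).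
apply: cnt_has_density => e e0.
  apply: (@block_growth R (fun v => _ - _) 4 _ _ _ _ sc) => // [v|k v kv].
    by rewrite lerBlDr (@le_trans _ _ v%:R) ?ler_nat ?cnt_leq // lerDl mulr_ge0.
  exact: (block_sumset_upper sc Bb (hlo k) kv).
have [y By] := Bneq0.
have [V HV] : exists V, forall v, (V <= v)%N ->
    alpha * v%:R - (cnt (fun x => `[< block_set P N h x >]) v)%:R <= e / 2 * v%:R.
  apply: (@block_growth R (fun v => _ - _) 2 _ _ _ _ sc) => // [v|k v kv|].
  - by rewrite lerBlDr (@le_trans _ _ v%:R) ?ler_piMl // lerDl.
  - exact: (block_set_lower sc (hP k) (hup k) kv).
  - by rewrite divr_gt0.
(* Half of [e] is spent on the block set, half on the loss [y] in [cnt_sumset_ge], absorbed once [v]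
   exceeds [y * 2 / e]. *)
exists (maxn V (Num.truncn (y%:R * 2 / e)).+1) => v Vv.
have := HV v ltac:(lia).
have : y%:R <= e / 2 * v%:R.
  rewrite mulrAC ler_pdivlMr // [e * _]mulrC -ler_pdivrMr //.
  by rewrite ltW // (lt_le_trans (truncnS_gt _)) // ler_nat (leq_trans _ Vv) ?leq_maxr.
have := cnt_sumset_ge (block_set P N h) v By.
rewrite -(ler_nat R) natrD.
have -> : e * v%:R = e / 2 * v%:R + e / 2 * v%:R by field.
by lra.
Qed.
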